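(* Let $W\subset\mathrm{GL}(V)$ be a reflection group, and let $\zeta$ and $\zeta'$ be roots of unity of orders $d$ and $d'$, respectively. Then $E(W,\zeta)=E(W,\zeta')$ if and only if $A(d)=A(d')$.
   Context: $V$ is an $n$-dimensional $\mathbb C$-vector space. A reflection in $V$ is a non-identity element of $\mathrm{GL}(V)$ of finite order that fixes some hyperplane pointwise; a reflection group is a finite subgroup $W\subset\mathrm{GL}(V)$ generated by reflections. The invariant ring $S(V^* )^W$ is generated by $n$ algebraically independent homogeneous polynomials, whose degrees $d_1\le\cdots\le d_n$ are uniquely determined by $W$. $A(d)$ is the multiset $\{d_i : d\mid d_i\}$ of degrees of $W$ divisible by $d$. For $g\in W$, $V(g,\zeta)=\{v\in V: gv=\zeta v\}$, and $E(W,\zeta)$ is the set of all subspaces $V(g,\zeta)$, $g\in W$, of $V$, ordered by reverse inclusion. *)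

(* Defs.v *)
From HB Require Import structures.
From mathcomp Require Import all_boot all_order all_algebra.
From mathcomp Require Import finmap multiset.
From mathcomp Require Import reals complex.
From mathcomp Require Import mpoly.

Set Implicit Arguments.
Unset Strict Implicit.
Unset Printing Implicit Defensive.

Import GRing.Theory.
Local Open Scope ring_scope.

Section ReflectionGroups.
Variables (K : fieldType) (V : vectType K).
Implicit Types (g r : 'End(V)) (W : {fset 'End(V)}).

Definition in_GL g : bool := lker g == 0%VS.

Definition is_reflection r : Prop :=
  [/\ in_GL r,
      r <> \1%VF,
      (exists2 k : nat, (0 < k)%N & iter k (comp_lfun r) \1%VF = \1%VF)
    & exists2 H : {vspace V},
        (\dim H).+1 = \dim {:V} & {in H, forall v, r v = v}].

Inductive generated (S : 'End(V) -> Prop) : 'End(V) -> Prop :=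
  | gen_one : generated S \1%VF
  | gen_mem g : S g -> generated S g
  | gen_mul g h : generated S g -> generated S h -> generated S (g \o h)%VF
  | gen_inv g : generated S g -> generated S (g^-1)%VF.

Definition is_finite_subgroup W : Prop :=
  [/\ {in W, forall g, in_GL g},
      \1%VF \in W,
      {in W &, forall g h, (g \o h)%VF \in W}
    & {in W, forall g, (g^-1)%VF \in W}].

Definition is_reflection_group W : Prop :=
  is_finite_subgroup W /\
  exists2 S : 'End(V) -> Prop,
    (forall r, S r -> is_reflection r)
    & (forall g, g \in W <-> generated S g).

Local Notation n := (\dim {:V}).

(* S(V^* ) is realized as {mpoly K[n]}: 'X_i stands for the i-th coordinate
   function of the basis vbasis {:V}.  The i-th entry of [coord_forms g] is
   the linear form v |-> (i-th coordinate of g v). *)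
Definition coord_forms g : n.-tuple {mpoly K[n]} :=
  [tuple \sum_(j < n) coord (vbasis {:V}) i (g (vbasis {:V})`_j) *: 'X_j
  | i < n].

(* (g . p)(v) = p(g^-1 v). *)
Definition poly_act g (p : {mpoly K[n]}) : {mpoly K[n]} :=
  p \mPo coord_forms (g^-1)%VF.

Definition is_invariant W (p : {mpoly K[n]}) : Prop :=
  {in W, forall g, poly_act g p = p}.

Definition alg_independent (f : n.-tuple {mpoly K[n]}) : Prop :=
  forall p : {mpoly K[n]}, p \mPo f = 0 -> p = 0.

Definition basic_invariants W (f : n.-tuple {mpoly K[n]}) : Prop :=
  alg_independent f /\
  forall q : {mpoly K[n]},
    is_invariant W q <-> exists p : {mpoly K[n]}, q = p \mPo f.

Definition is_degrees W (ds : n.-tuple nat) : Prop :=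
  sorted leq ds /\
  exists2 f : n.-tuple {mpoly K[n]},
    basic_invariants W f
    & forall i : 'I_n, tnth f i \is (tnth ds i).-homog.

(* Being a set of subspaces of V, E(W, zeta) carries a reverse inclusion order
   that is determined by the set itself. *)
Definition eigenspaces W (zeta : K) : {fset {vspace V}} :=
  [fset passmx.leigenspace g zeta | g in W]%fset.

End ReflectionGroups.

Definition degrees_divisible (ds : seq nat) (d : nat) : {mset nat}%mset :=
  seq_mset [seq x <- ds | (d %| x)%N].

(* Main.v *)
(* Let f_1, ..., f_n be basic invariants.  As invariants separate orbits, v and
   zeta v are W-conjugate iff f_i(v) = zeta^(d_i) f_i(v) for all i, so the union
   U(zeta) of the members of E(W,zeta) is the common zero set of the f_i with d
   not dividing d_i.  The map (f_1, ..., f_n) : V -> C^n is surjective, hence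
   U(zeta) = U(zeta') iff d and d' divide the same d_i.  It remains to see that
   U(zeta) determines E(W,zeta).  A subspace X lies in U(zeta) iff it lies in
   some V(g,zeta), and then the number of such g is the order of the pointwise
   stabilizer of X; Moebius inversion yields the number of g with
   V(g,zeta) = X. *)
Require Import Defs.
From HB Require Import structures.
From mathcomp Require Import all_boot all_order all_algebra.
From mathcomp Require Import finmap multiset.
From mathcomp Require Import reals complex.
From mathcomp Require Import boolp.
From mathcomp Require Import mpoly.
From mathcomp Require Import ring.

Set Implicit Arguments.
Unset Strict Implicit.
Unset Printing Implicit Defensive.

Import GRing.Theory.
Local Open Scope ring_scope.

(** * Subspaces covered by finitely many subspaces *)

Lemma sum_Xn_neq0 (K : fieldType) (n : nat) (c : 'I_n -> K) (i : 'I_n) :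
  c i != 0 -> \sum_(j < n) c j *: 'X^j != 0 :> {poly K}.
Proof.
move=> ci; apply/eqP => /(congr1 (fun p : {poly K} => p`_i)).
rewrite coef0 coef_sum (bigD1 i) //= big1 => [|j ji].
  by rewrite addr0 coefZ coefXn eqxx mulr1 => /eqP; rewrite (negPf ci).
by rewrite coefZ coefXn eq_sym (inj_eq val_inj) (negPf ji) mulr0.
Qed.

(** The curve [v t], whose coordinates in a basis of X are the powers of t, meets a subspace not
    containing X only at roots of a nonzero polynomial. If no member of [Us] contained X, a value of
    t avoiding the roots of the product of these polynomials would give a point of X that is not
    covered. *)
Lemma subv_covered (K : closedFieldType) (V : vectType K) (X : {vspace V})
    (Us : seq {vspace V}) :
  (forall v, v \in X -> exists2 U, U \in Us & v \in U) ->
  exists2 U, U \in Us & (X <= U)%VS.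
Proof.
move=> covX; apply/hasP; apply: contraT; rewrite -all_predC => /allP nX.
pose v (t : K) := \sum_(i < \dim X) t ^+ i *: (vbasis X)`_i.
suff [P P_neq0 P_root] : exists2 P : {poly K}, P != 0 &
    forall t U, U \in Us -> v t \in U -> root P t.
  have [t nrt] := closed_nonrootP P P_neq0.
  have /covX [U UUs vU] : v t \in X.
    by apply: memv_suml => i _; rewrite memvZ // vbasis_mem // mem_nth // size_tuple.
  by move: nrt; rewrite (P_root t U).
elim: Us nX {covX} => [_|U Us IH nX]; first by exists 1; rewrite ?oner_eq0.
have [|P P_neq0 P_root] := IH; first by move=> U' U'Us; apply: nX; rewrite inE U'Us orbT.
have /subvPn [w /coord_vbasis -> wU] : ~~ (X <= U)%VS by apply: nX; rewrite mem_head.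
have [i bU] : exists i : 'I_(\dim X), (vbasis X)`_i \notin U.
  apply/existsP; apply: contraR wU => /existsPn bU.
  by apply: memv_suml => i _; rewrite memvZ // (negPn (bU i)).
pose q x := x - projv U x.
have [k qk] : exists k, coord (vbasis {:V}) k (q (vbasis X)`_i) != 0.
  apply/existsP; apply: contraR bU => /existsPn qk.
  suff /eqP : q (vbasis X)`_i = 0 by rewrite subr_eq0 => /eqP ->; apply: memv_proj.
  rewrite [LHS](coord_vbasis (memvf _)) big1 // => k _.
  by rewrite (eqP (negPn (qk k))) scale0r.
pose c (j : 'I_(\dim X)) := coord (vbasis {:V}) k (q (vbasis X)`_j).
exists (P * \sum_j c j *: 'X^j).
  by rewrite mulf_neq0 // (@sum_Xn_neq0 _ _ c i).
move=> t U'; rewrite rootM inE => /predU1P [-> vtU|U'Us vtU']; last first.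
  by rewrite (P_root _ _ U'Us vtU').
apply/orP; right; rewrite /root horner_sum.
have <- : coord (vbasis {:V}) k (q (v t)) =
    \sum_(j < \dim X) (c j *: 'X^j).[t].
  rewrite /q /v [projv _ _]linear_sum -sumrB linear_sum; apply: eq_bigr => j _ /=.
  by rewrite linearZ -scalerBr linearZ /= hornerZ hornerXn mulrC.
by rewrite /q projv_id // subrr linear0.
Qed.

(** * Counting group elements by their eigenspaces *)

Section FiniteSubgroup.
Variables (K : fieldType) (V : vectType K) (W : {fset 'End(V)}).
Hypothesis W_grp : is_finite_subgroup W.
Implicit Types g h : 'End(V).

Lemma memW_GL g : g \in W -> lker g == 0%VS.
Proof. by case: W_grp => GL _ _ _; apply: GL. Qed.

Lemma memW1 : \1%VF \in W. Proof. by case: W_grp. Qed.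

Lemma memWM g h : g \in W -> h \in W -> (g \o h)%VF \in W.
Proof. by case: W_grp => _ _ M _; apply: M. Qed.

Lemma memWV g : g \in W -> (g^-1)%VF \in W.
Proof. by case: W_grp => _ _ _; apply. Qed.

Lemma perm_mulW g : g \in W -> perm_eq [seq (g \o h)%VF | h <- W] W.
Proof.
move=> gW; have g0 := memW_GL gW.
have injg : injective (fun h => (g \o h)%VF).
  by move=> h h' /(congr1 (comp_lfun g^-1)); rewrite !lker0_compKf.
apply: uniq_perm; rewrite ?map_inj_uniq ?fset_uniq // => h.
apply/mapP/idP => [[h' h'W ->]|hW]; first exact: memWM.
by exists (g^-1 \o h)%VF; [rewrite memWM ?memWV | rewrite lker0_compVKf].
Qed.

Lemma mem_leigenspace g (z : K) v :
  (v \in passmx.leigenspace g z) = (g v == z *: v).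
Proof.
by rewrite /passmx.leigenspace memv_ker add_lfunE opp_lfunE scale_lfunE id_lfunE subr_eq0.
Qed.

Lemma mem_eigenspaces (z : K) X :
  (X \in eigenspaces W z) = has (fun g => passmx.leigenspace g z == X) W.
Proof.
apply/imfsetP/hasP => /= [[g gW ->]|[g gW /eqP <-]]; exists g => //.
Qed.

(** If g acts on X as the scalar z, then left multiplication by g is a bijection from the pointwise
    stabilizer of X onto the elements acting on X as z. *)
Lemma count_eigenspace_le (z : K) (X : {vspace V}) :
  count (fun g => (X <= passmx.leigenspace g z)%VS) W =
  if has (fun g => (X <= passmx.leigenspace g z)%VS) W
  then count (fun g => (X <= passmx.leigenspace g 1)%VS) W else 0.
Proof.
case: ifPn => [/hasP [g gW Xg]|]; last by rewrite has_count lt0n negbK => /eqP.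
rewrite -(permP (perm_mulW gW)) count_map; apply: eq_in_count => h hW /=.
have g0 := memW_GL gW.
apply/subvP/subvP => Xh v vX; have := subvP Xg v vX; rewrite !mem_leigenspace => /eqP gv.
  have := Xh v vX; rewrite mem_leigenspace comp_lfunE -gv scale1r.
  by move/eqP/(lker0P g0) => ->.
by have := Xh v vX; rewrite mem_leigenspace comp_lfunE scale1r => /eqP ->; apply/eqP.
Qed.

(** Moebius inversion, carried out as an induction on the codimension of X: by [count_eigenspace_le]
    the numbers of g whose eigenspace contains X agree for z and z', and the contributions of the
    strictly larger subspaces agree by induction. *)
Lemma count_eigenspace_eq (z z' : K) :
  (forall X, has (fun g => (X <= passmx.leigenspace g z)%VS) W =
             has (fun g => (X <= passmx.leigenspace g z')%VS) W) ->
  forall X, count (fun g => passmx.leigenspace g z == X) W =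
            count (fun g => passmx.leigenspace g z' == X) W.
Proof.
move=> same_has X; have [n] := ubnP (\dim {:V} - \dim X).
elim: n X => // n IH X; rewrite ltnS => ltn.
(* One list serves both z and z', so that the two sums over larger subspaces have the same index
   set. *)
pose L := undup ([seq passmx.leigenspace g z | g <- W] ++
                 [seq passmx.leigenspace g z' | g <- W]).
have split y : (forall g, g \in W -> passmx.leigenspace g y \in L) ->
  count (fun g => (X <= passmx.leigenspace g y)%VS) W =
  (count (fun g => passmx.leigenspace g y == X) W +
   \sum_(Y <- L | (X <= Y)%VS && (Y != X))
      count (fun g => passmx.leigenspace g y == Y) W)%N.
  move=> yL; under eq_bigr do rewrite -sum1_count.
  rewrite (exchange_big_dep xpredT) //= -!sum1_count big_mkcond /=.
  rewrite [X in (X + _)%N]big_mkcond -big_split /=.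
  rewrite big_seq [RHS]big_seq; apply: eq_bigr => g gW.
  have uL : uniq L by apply: undup_uniq.
  (* Each g contributes to a single count, that of its own eigenspace [Y0], which occurs in L
     exactly once. *)
  set Y0 := passmx.leigenspace g y.
  rewrite (eq_bigl (fun Y => (Y == Y0) && ((X <= Y0)%VS && (Y0 != X)))); last first.
    by move=> Y; rewrite andbC [Y == Y0]eq_sym; case: (eqVneq Y0 Y) => [<-|].
  rewrite -big_filter_cond /= filter_pred1_uniq ?yL // big_mkcond big_seq1.
  have [->|_] := eqVneq Y0 X; first by rewrite subvv andbF.
  by rewrite andbT; case: ifP.
have zL g : g \in W -> passmx.leigenspace g z \in L.
  by move=> gW; rewrite mem_undup mem_cat (map_f (fun g => passmx.leigenspace g z)).
have z'L g : g \in W -> passmx.leigenspace g z' \in L.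
  by move=> gW; rewrite mem_undup mem_cat orbC (map_f (fun g => passmx.leigenspace g z')).
have := count_eigenspace_le z X.
rewrite same_has -count_eigenspace_le (split _ zL) (split _ z'L).
rewrite [X in (_ + X)%N = _ -> _](eq_bigr
   (fun Y => count (fun g => passmx.leigenspace g z' == Y) W)).
  by move=> /eqP; rewrite eqn_add2r => /eqP.
move=> Y /andP [XY nYX]; apply: IH; apply: leq_trans ltn.
have dXY : (\dim X < \dim Y)%N.
  rewrite ltn_neqAle dimvS // andbT; apply: contra nYX => dXY.
  by rewrite eq_sym eqEdim XY (eqP dXY) leqnn.
by apply: ltn_sub2l => //; apply: leq_trans dXY _; rewrite dimvS ?subvf.
Qed.

End FiniteSubgroup.

Lemma has_eigenspace_le (K : closedFieldType) (V : vectType K)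
    (W : {fset 'End(V)}) (z : K) (X : {vspace V}) :
  has (fun g => (X <= passmx.leigenspace g z)%VS) W <->
  forall v, v \in X -> exists2 g, g \in W & g v = z *: v.
Proof.
split=> [/hasP [g gW Xg] v vX|covX].
  by exists g => //; apply/eqP; rewrite -mem_leigenspace (subvP Xg).
have [|_ /mapP [g gW ->] Xg] :=
    @subv_covered _ _ X [seq passmx.leigenspace g z | g <- W].
  move=> v /covX [g gW gv]; exists (passmx.leigenspace g z); first by apply/mapP; exists g.
  by rewrite mem_leigenspace gv.
by apply/hasP; exists g.
Qed.

Lemma eigenspaces_eqP (K : closedFieldType) (V : vectType K)
    (W : {fset 'End(V)}) (z z' : K) : is_finite_subgroup W ->
  eigenspaces W z = eigenspaces W z' <->
  forall v, (exists2 g, g \in W & g v = z *: v) <->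
            (exists2 g, g \in W & g v = z' *: v).
Proof.
move=> W_grp; split=> [eqE v|eqU].
  have sub y y' : eigenspaces W y = eigenspaces W y' ->
      (exists2 g, g \in W & g v = y *: v) -> exists2 g, g \in W & g v = y' *: v.
    move=> eqy [g gW gv].
    have : passmx.leigenspace g y \in eigenspaces W y'.
      by rewrite -eqy mem_eigenspaces; apply/hasP; exists g.
    rewrite mem_eigenspaces => /hasP [h hW /eqP hg]; exists h => //.
    by apply/eqP; rewrite -mem_leigenspace hg mem_leigenspace gv.
  by split; apply: sub.
(* Membership in the set of eigenspaces means that the count is positive, and the counts agree. *)
apply/fsetP => X; rewrite (mem_eigenspaces W z) (mem_eigenspaces W z') !has_count.
rewrite (count_eigenspace_eq W_grp (z' := z')) // => Y.
by apply/idP/idP => /has_eigenspace_le cov; apply/has_eigenspace_le => v /cov;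
  rewrite eqU.
Qed.

(** * Ideals and a weak Nullstellensatz *)

Section Ideals.
Variable S : comNzRingType.
Implicit Types J : S -> Prop.

Definition is_ideal J : Prop :=
  [/\ J 0, forall x y, J x -> J y -> J (x + y) & forall a x, J x -> J (a * x)].

Definition ideal_adjoin J (x y : S) : Prop :=
  exists2 u, J u & exists a, y = u + a * x.

Lemma ideal_adjoin_ideal J x : is_ideal J -> is_ideal (ideal_adjoin J x).
Proof.
case=> J0 JD JM; split.
- by exists 0 => //; exists 0; rewrite mul0r addr0.
- move=> _ _ [u Ju [a ->]] [u' Ju' [a' ->]]; exists (u + u'); first exact: JD.
  by exists (a + a'); rewrite mulrDl addrACA.
- move=> b _ [u Ju [a ->]]; exists (b * u); first exact: JM.
  by exists (b * a); rewrite mulrDr mulrA.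
Qed.

(** If 1 were in J + (x - r) for every r in s, multiplying these expressions of 1 would put 1 into J
    + (P) with P the product of all x - r; this ideal is J itself. *)
Lemma proper_ideal_adjoin_root J x (s : seq S) :
  is_ideal J -> ~ J 1 -> J (\prod_(r <- s) (x - r)) ->
  exists2 r, r \in s & ~ ideal_adjoin J (x - r) 1.
Proof.
move=> [J0 JD JM] nJ1 Js; apply: contrapT => nproper; apply: nJ1.
suff [u Ju [a ->]] : ideal_adjoin J (\prod_(r <- s) (x - r)) 1.
  by apply: JD => //; apply: JM.
have {nproper Js} : forall r, r \in s -> ideal_adjoin J (x - r) 1.
  by move=> r rs; apply: contrapT => nJr; apply: nproper; exists r.
elim: s => [_|r s IH Js].
  by exists 0 => //; exists 1; rewrite big_nil mulr1 add0r.
have [u Ju [a E]] := Js r (mem_head _ _).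
have [|u' Ju' [a' E']] := IH; first by move=> r' r's; apply: Js; rewrite inE r's orbT.
rewrite big_cons; set P := \prod_(_ <- _) _ in E' *.
(* This is the part lying in J when (u + a (x - r)) (u' + a' P) is expanded; the remaining term is a
   a' (x - r) P. *)
exists ((u' + a' * P) * u + a * (x - r) * u'); first by apply: JD; apply: JM.
by exists (a * a'); rewrite -[LHS]mulr1 {1}E E'; ring.
Qed.

End Ideals.

Section IdealPoints.
Variables (K : closedFieldType) (n : nat).

(** Congruence modulo J respects sums and products. This is applied with [lq] the variables, to
    evaluate at a point, and with [lq] the basic invariants, to turn invariants into constants. *)
Lemma ideal_comp_mpoly_cong (m : nat) (J : {mpoly K[m]} -> Prop)
    (lq : n.-tuple {mpoly K[m]}) (c : 'I_n -> K) :
  is_ideal J -> (forall i, J (tnth lq i - (c i)%:MP)) ->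
  forall p : {mpoly K[n]}, J (p \mPo lq - (p.@[c])%:MP).
Proof.
move=> [J0 JD JM] Jc.
have JX y y' z z' : J (y - z) -> J (y' - z') -> J (y * y' - z * z').
  move=> Jy Jy'; have -> : y * y' - z * z' = y * (y' - z') + z' * (y - z) by ring.
  by apply: JD; apply: JM.
have J_refl y : J (y - y) by rewrite subrr.
move=> p; rewrite comp_mpolyEX mevalE rmorph_sum -sumrB /=.
elim/big_rec: _ => // mm y _ Jy; apply: JD => //.
rewrite -mul_mpolyC comp_mpolyX rmorphM rmorph_prod /=; apply: (JX) => //.
elim/big_rec2: _ => // i y1 y2 _ Jy12; apply: (JX) => //.
by rewrite rmorphXn /=; elim: (mm i) => // k Jk; rewrite !exprS; apply: JX.
Qed.

(* Weak Nullstellensatz in the case where every coordinate is algebraic modulo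
   the ideal: one root at a time is adjoined to the ideal. *)
Lemma ideal_point (J : {mpoly K[n]} -> Prop) :
  is_ideal J -> ~ J 1 ->
  (forall k, exists2 P : {poly K}, P != 0 & J (map_poly (@mpolyC n K) P).['X_k]) ->
  exists a : 'I_n -> K, forall q, J q -> q.@[a] = 0.
Proof.
move=> J_ideal nJ1 J_alg.
have [J' [J'_ideal nJ'1 JJ' J'X]] : exists J' : {mpoly K[n]} -> Prop,
    [/\ is_ideal J', ~ J' 1, forall q, J q -> J' q
      & forall k, k \in enum 'I_n -> exists r : K, J' ('X_k - r%:MP)].
  elim: (enum _) => [|k ks [J' [J'_ideal nJ'1 JJ' J'X]]]; first by exists J; split.
  have [P P_neq0 /JJ' J'P] := J_alg k.
  have [rs def_P] := closed_field_poly_normal P.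
  have J'rs : J' (\prod_(r <- map (@mpolyC n K) rs) ('X_k - r)).
    have [_ _ J'M] := J'_ideal; move/(J'M (lead_coef P)^-1%:MP): J'P.
    rewrite [in map_poly _ _]def_P map_polyZ hornerZ mulrA -rmorphM /=.
    rewrite mulVf ?lead_coef_eq0 // mul1r rmorph_prod horner_prod big_map.
    by under eq_bigr => r _ do rewrite /= map_polyXsubC hornerXsubC.
  have [_ /mapP [r _ ->] nJr1] := proper_ideal_adjoin_root J'_ideal nJ'1 J'rs.
  have J'sub q : J' q -> ideal_adjoin J' ('X_k - r%:MP) q.
    by move=> J'q; exists q => //; exists 0; rewrite mul0r addr0.
  exists (ideal_adjoin J' ('X_k - r%:MP)); split=> //.
  - exact: ideal_adjoin_ideal.
  - by move=> q /JJ' /J'sub.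
  move=> k'; rewrite inE => /predU1P [->|/J'X [r' J'r']]; last by exists r'; apply: J'sub.
  by exists r; exists 0; [case: J'_ideal | exists 1; rewrite mul1r add0r].
have [a J'a] : exists a : 'I_n -> K, forall k, J' ('X_k - (a k)%:MP).
  by apply: (fin_all_exists (P := fun k r => J' ('X_k - r%:MP))) => k;
    apply: J'X; rewrite mem_enum.
exists a => q /JJ' J'q; have [J0 JD JM] := J'_ideal.
have J'lq i : J' (tnth [tuple 'X_i | i < n] i - (a i)%:MP) by rewrite tnth_mktuple.
have := ideal_comp_mpoly_cong J'_ideal J'lq q.
(* Both q and q - q(a) lie in [J'], hence so does the constant q(a); if nonzero it would be a
   unit. *)
rewrite comp_mpoly_id => J'qa; apply/eqP; apply: contrapT => /negP qa0; apply: nJ'1.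
have : J' (q.@[a])%:MP.
  have -> : (q.@[a])%:MP = q + -1 * (q - (q.@[a])%:MP) :> {mpoly K[n]} by ring.
  by apply: JD => //; apply: JM.
by move/(JM (q.@[a])^-1%:MP); rewrite -rmorphM /= mulVf.
Qed.

End IdealPoints.

(** * Evaluation, substitution and the linear action on polynomials *)

Lemma meval_homog_scale (K : comNzRingType) (n d : nat) (p : {mpoly K[n]})
    (z : K) (x : 'I_n -> K) :
  p \is d.-homog -> p.@[fun i => z * x i] = z ^+ d * p.@[x].
Proof.
move=> /dhomogP p_homog; rewrite !mevalE mulr_sumr !big_seq; apply: eq_bigr => m mp.
have /= <- := p_homog m mp; rewrite mdegE mulrCA; congr (_ * _).
by rewrite expr_sum -big_split /=; apply: eq_bigr => i _; rewrite exprMn.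
Qed.

Lemma comp_mpolyX_tnth (K : comNzRingType) (k l : nat)
    (lq : k.-tuple {mpoly K[l]}) (i : 'I_k) : 'X_i \mPo lq = tnth lq i.
Proof. by rewrite comp_mpolyXU -tnth_nth. Qed.

Lemma comp_mpolyA (K : comNzRingType) (k l m : nat) (p : {mpoly K[k]})
    (lq : k.-tuple {mpoly K[l]}) (lr : l.-tuple {mpoly K[m]}) :
  (p \mPo lq) \mPo lr = p \mPo [tuple tnth lq i \mPo lr | i < k].
Proof.
rewrite !(comp_mpolyEX p) linear_sum; apply: eq_bigr => mm _ /=.
rewrite comp_mpolyZ !comp_mpolyX rmorph_prod; congr (_ *: _).
by apply: eq_bigr => i _; rewrite rmorphXn tnth_mktuple.
Qed.

Section Invariants.
Variables (K : fieldType) (V : vectType K).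
Local Notation n := (\dim {:V}).
Implicit Types (g h : 'End(V)) (p : {mpoly K[n]}).

Definition coords (v : V) (i : 'I_n) : K := coord (vbasis {:V}) i v.

Lemma coords_surj (a : 'I_n -> K) : exists v, coords v =1 a.
Proof.
exists (\sum_i a i *: (vbasis {:V})`_i) => i.
by rewrite /coords coord_sum_free // (basis_free (vbasisP _)).
Qed.

Lemma coords_inj v w : coords v =1 coords w -> v = w.
Proof.
move=> vw; rewrite (coord_vbasis (memvf v)) (coord_vbasis (memvf w)).
by apply: eq_bigr => i _; congr (_ *: _); apply: vw.
Qed.

Lemma coordsE g v i :
  coords (g v) i = \sum_(j < n) coord (vbasis {:V}) i (g (vbasis {:V})`_j) * coords v j.
Proof.
rewrite /coords {1}(coord_vbasis (memvf v)) !linear_sum; apply: eq_bigr => j _ /=.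
by rewrite !linearZ mulrC.
Qed.

Lemma meval_poly_act g p v :
  (poly_act g p).@[coords v] = p.@[coords ((g^-1)%VF v)].
Proof.
rewrite /poly_act comp_mpoly_meval; apply: meval_eq => i.
rewrite tnth_mktuple coordsE linear_sum; apply: eq_bigr => j _ /=.
by rewrite mevalZ mevalXU.
Qed.

Lemma coord_formsM g h i :
  tnth (coord_forms g) i \mPo coord_forms h = tnth (coord_forms (g \o h)%VF) i.
Proof.
rewrite !tnth_mktuple linear_sum /=.
under eq_bigr => j _ do rewrite comp_mpolyZ comp_mpolyX_tnth tnth_mktuple scaler_sumr.
rewrite exchange_big; apply: eq_bigr => k _ /=.
rewrite comp_lfunE [coord _ i (g _)]coordsE scaler_suml; apply: eq_bigr => j _.
by rewrite scalerA.
Qed.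

(** Substitution reverses the order of composition, and so does inversion; together they make
    [poly_act] a left action. *)
Lemma poly_actM g h p : lker g == 0%VS -> lker h == 0%VS ->
  poly_act g (poly_act h p) = poly_act (g \o h)%VF p.
Proof.
move=> g0 h0; rewrite /poly_act comp_mpolyA; congr comp_mpoly.
have -> : ((g \o h)^-1 = h^-1 \o g^-1)%VF.
  have gh0 : lker (g \o h)%VF == 0%VS.
    by apply/lker0P => v w; rewrite !comp_lfunE => /(lker0P g0) /(lker0P h0).
  apply/lfunP => v; apply/(lker0P gh0).
  by rewrite lker0_lfunVK // !comp_lfunE !lker0_lfunVK.
by apply: eq_from_tnth => i; rewrite tnth_mktuple coord_formsM.
Qed.

End Invariants.

(** * Orbit polynomials and separation of orbits *)

Section OrbitPolynomial.
Variables (K : fieldType) (V : vectType K) (W : {fset 'End(V)}).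
Hypothesis W_grp : is_finite_subgroup W.
Local Notation n := (\dim {:V}).
Implicit Types (g h : 'End(V)) (p : {mpoly K[n]}).

Lemma lfun_inv1 : ((\1 : 'End(V))^-1 = \1)%VF.
Proof.
by rewrite -[LHS]comp_lfun1l lker0_compfV //; apply/lker0P => v w; rewrite !id_lfunE.
Qed.

Lemma poly_act1 p : poly_act \1%VF p = p.
Proof.
rewrite /poly_act lfun_inv1 -[RHS]comp_mpoly_id; congr comp_mpoly.
apply: eq_from_tnth => i; rewrite !tnth_mktuple (bigD1 i) //= big1 => [|j ji].
  by rewrite id_lfunE coord_free ?eqxx ?scale1r ?addr0 // (basis_free (vbasisP _)).
by rewrite id_lfunE coord_free ?(basis_free (vbasisP _)) //
  (negPf ji) scale0r.
Qed.

Definition orbit_poly p : {poly {mpoly K[n]}} :=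
  \prod_(h <- W) ('X - (poly_act h p)%:P).

Lemma orbit_poly_monic p : orbit_poly p \is monic.
Proof. exact: monic_prod_XsubC. Qed.

Lemma orbit_poly_root p : (orbit_poly p).[p] = 0.
Proof.
rewrite /orbit_poly (big_fsetD1 _ (memW1 W_grp)) /= hornerM.
by rewrite poly_act1 hornerXsubC subrr mul0r.
Qed.

(** Applying g to all coefficients is a ring morphism, and it permutes the linear factors because h
    |-> gh permutes W. *)
Lemma orbit_poly_invariant p i : is_invariant W (orbit_poly p)`_i.
Proof.
move=> g gW; rewrite {1}/poly_act -coef_map /=; congr (polyseq _)`_i.
rewrite /orbit_poly rmorph_prod -[RHS](perm_big _ (perm_mulW W_grp gW)) big_map /=.
rewrite !big_seq; apply: eq_bigr => h hW; rewrite map_polyXsubC.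
by rewrite -(poly_actM _ (memW_GL W_grp gW) (memW_GL W_grp hW)).
Qed.

Lemma orbit_poly_meval p v t :
  (map_poly (meval (coords v)) (orbit_poly p)).[t] =
  \prod_(h <- W) (t - p.@[coords ((h^-1)%VF v)]).
Proof.
rewrite /orbit_poly rmorph_prod horner_prod; apply: eq_bigr => h _ /=.
by rewrite map_polyXsubC hornerXsubC /= meval_poly_act.
Qed.

End OrbitPolynomial.

(* The linear forms l_t = \sum_i t ^ i X_i are tested through the invariant
   coefficients of their orbit polynomials; for v, w in distinct orbits,
   \prod_h l_t (w - h v) is a nonzero polynomial in t. *)
Lemma invariants_separate_orbits (K : closedFieldType) (V : vectType K)
    (W : {fset 'End(V)}) (v w : V) : is_finite_subgroup W ->
  (forall q, is_invariant W q -> q.@[coords v] = q.@[coords w]) ->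
  exists2 g, g \in W & g v = w.
Proof.
move=> W_grp vw.
suff /hasP [h hW /eqP hv] : has (fun h : 'End(V) => (h^-1)%VF v == w) W.
  by exists (h^-1)%VF => //; apply: memWV.
apply: contraT; rewrite -all_predC => /allP no_h.
pose D (h : 'End(V)) : {poly K} :=
  \sum_(i < \dim {:V}) (coords w i - coords ((h^-1)%VF v) i) *: 'X^i.
have /closed_nonrootP [t] : \prod_(h <- W) D h != 0.
  rewrite prodf_seq_neq0; apply/allP => h hW /=.
  have [i di] : exists i, coords w i - coords ((h^-1)%VF v) i != 0.
    apply/existsP; apply: contraR (no_h h hW) => /existsPn eq_vw /=.
    by apply/eqP/coords_inj => i; apply/esym/eqP; rewrite -subr_eq0 (negPn (eq_vw i)).
  exact: (@sum_Xn_neq0 _ _ (fun i => coords w i - coords ((h^-1)%VF v) i) i).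
case/negP; rewrite /root horner_prod.
pose l : {mpoly K[\dim {:V}]} := \sum_(i < \dim {:V}) t ^+ i *: 'X_i.
have lE u : l.@[coords u] = \sum_(i < \dim {:V}) t ^+ i * coords u i.
  by rewrite /l rmorph_sum; apply: eq_bigr => i _; rewrite /= mevalZ mevalXU.
(* The product is the orbit polynomial of [l], specialized at v and evaluated at l(w). Its
   coefficients are invariant, so v may be replaced by w, and then it vanishes because [l] is a root
   of its own orbit polynomial. *)
have -> : \prod_(h <- W) (D h).[t] =
    (map_poly (meval (coords v)) (orbit_poly W l)).[l.@[coords w]].
  rewrite orbit_poly_meval; apply: eq_bigr => h _.
  rewrite horner_sum !lE -sumrB; apply: eq_bigr => i _.
  by rewrite hornerZ hornerXn mulrC mulrBr.
have -> : map_poly (meval (coords v)) (orbit_poly W l) =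
    map_poly (meval (coords w)) (orbit_poly W l).
  by apply/polyP => i; rewrite !coef_map; apply/vw/orbit_poly_invariant.
by rewrite horner_map orbit_poly_root // rmorph0.
Qed.

(** * The map given by the basic invariants: its fibers and surjectivity *)

Section BasicInvariants.
Variables (K : numClosedFieldType) (V : vectType K) (W : {fset 'End(V)}).
Hypothesis W_grp : is_finite_subgroup W.
Local Notation n := (\dim {:V}).
Variable f : n.-tuple {mpoly K[n]}.
Hypothesis f_basic : basic_invariants W f.

Lemma basic_invariant i : is_invariant W (tnth f i).
Proof.
by case: f_basic => _ /(_ (tnth f i)) [_]; apply; exists 'X_i; rewrite comp_mpolyX_tnth.
Qed.

Lemma basic_invariants_separate v w :
  (forall i, (tnth f i).@[coords v] = (tnth f i).@[coords w]) ->
  exists2 g, g \in W & g v = w.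
Proof.
move=> vw; apply: invariants_separate_orbits => // q.
case: f_basic => _ /(_ q) [inv_q _] /inv_q [p ->].
by rewrite !comp_mpoly_meval; apply: meval_eq.
Qed.

(** The zero set of this ideal is the fiber over c of the map f. *)
Definition fiber_ideal (c : 'I_n -> K) (q : {mpoly K[n]}) : Prop :=
  exists u : 'I_n -> {mpoly K[n]}, q = \sum_i u i * (tnth f i - (c i)%:MP).

Lemma fiber_ideal_ideal c : is_ideal (fiber_ideal c).
Proof.
split.
- by exists (fun=> 0); rewrite big1 // => i _; rewrite mul0r.
- move=> _ _ [u ->] [u' ->]; exists (fun i => u i + u' i).
  by rewrite -big_split; apply: eq_bigr => i _; rewrite mulrDl.
- move=> a _ [u ->]; exists (fun i => a * u i).
  by rewrite mulr_sumr; apply: eq_bigr => i _; rewrite mulrA.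
Qed.

(* Summing a relation 1 = \sum_i u_i (f_i - c_i) over W makes the coefficients
   invariant, hence polynomials in f, against algebraic independence. *)
Lemma fiber_ideal_proper c : ~ fiber_ideal c 1.
Proof.
case=> u E; have [f_indep f_gen] := f_basic.
pose s i := \sum_(g <- W) poly_act g (u i).
have s_inv i : is_invariant W (s i).
  move=> g gW; rewrite {1}/poly_act linear_sum /= /s.
  rewrite -[RHS](perm_big _ (perm_mulW W_grp gW)) big_map.
  rewrite [LHS]big_seq [RHS]big_seq; apply: eq_bigr => h hW.
  by rewrite -(poly_actM _ (memW_GL W_grp gW) (memW_GL W_grp hW)).
have [p sE] : exists p : 'I_n -> {mpoly K[n]}, forall i, s i = p i \mPo f.
  by apply: (fin_all_exists (P := fun i p => s i = p \mPo f)) => i;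
    apply/(f_gen (s i)).1/s_inv.
have sum1 : (#|` W|)%:R = \sum_i s i * (tnth f i - (c i)%:MP) :> {mpoly K[n]}.
  rewrite [RHS](eq_bigr (fun i =>
    \sum_(g <- W) poly_act g (u i * (tnth f i - (c i)%:MP)))); last first.
    move=> i _; rewrite mulr_suml !big_seq; apply: eq_bigr => g gW.
    have fi_inv := @basic_invariant i g gW.
    by rewrite /poly_act rmorphM rmorphB /= [tnth f i \mPo _]fi_inv comp_mpolyC.
  rewrite exchange_big /= -sum1_size natr_sum; apply: eq_bigr => g _.
  by rewrite -[LHS](comp_mpoly1 (coord_forms g^-1)%VF) {1}E linear_sum.
have : (#|` W|)%:R - \sum_i p i * ('X_i - (c i)%:MP) = 0 :> {mpoly K[n]}.
  apply: f_indep; rewrite rmorphB rmorph_nat sum1 /= [_ \mPo f]linear_sum -sumrB big1 // => i _.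
  by rewrite rmorphM rmorphB /= comp_mpolyX_tnth comp_mpolyC -sE subrr.
(* Evaluation at c kills every term of the sum and leaves |W| = 0, which is impossible in
   characteristic 0. *)
move/(congr1 (meval c)); rewrite rmorphB rmorph_nat rmorph0 rmorph_sum /= big1 => [|i _].
  move/eqP; rewrite subr0 Num.Theory.pnatr_eq0 cardfs_eq0 => /eqP W0.
  by have := memW1 W_grp; rewrite W0 inE.
by rewrite rmorphM rmorphB /= mevalXU mevalC subrr mulr0.
Qed.

(** The variable ['X_k] is a root of its monic orbit polynomial, whose coefficients are polynomials
    in f and hence congruent to constants modulo the ideal. Replacing them by these constants gives
    P. *)
Lemma fiber_ideal_algebraic c k :
  exists2 P : {poly K}, P != 0 & fiber_ideal c (map_poly (@mpolyC n K) P).['X_k].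
Proof.
pose Phi := orbit_poly W 'X_k; pose N := (size Phi).-1.
have [J0 JD JM] := fiber_ideal_ideal c.
have Jf i : fiber_ideal c (tnth f i - (c i)%:MP).
  exists (fun j => (j == i)%:R); rewrite (bigD1 i) //= eqxx mul1r big1 ?addr0 //.
  by move=> j /negPf ->; rewrite mul0r.
have [e Phi_e] : exists e : 'I_N -> K,
    forall j, fiber_ideal c ((e j)%:MP - Phi`_j).
  apply: (fin_all_exists (P := fun (j : 'I_N) e => fiber_ideal c (e%:MP - Phi`_j))) => j.
  have /f_basic.2 [p ->] := orbit_poly_invariant W_grp 'X_k j.
  exists p.@[c]; rewrite -opprB -mulN1r; apply: JM.
  exact: (ideal_comp_mpoly_cong (fiber_ideal_ideal c) Jf).
exists ('X^N + \sum_(j < N) e j *: 'X^j).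
  apply/eqP => /(congr1 (fun P : {poly K} => P`_N)).
  rewrite coefD coefXn eqxx coef_sum coef0 big1 ?addr0 => [/eqP|j _].
    by rewrite oner_eq0.
  by rewrite coefZ coefXn eq_sym ltn_eqF // mulr0.
have Phi_monic : Phi \is monic by apply: orbit_poly_monic.
(* Subtracting Phi('X_k) = 0 from P('X_k) cancels the leading terms and leaves the differences of
   the lower coefficients. *)
have -> : (map_poly (@mpolyC n K) ('X^N + \sum_(j < N) e j *: 'X^j)).['X_k] =
    \sum_(j < N) 'X_k ^+ j * ((e j)%:MP - Phi`_j).
  rewrite rmorphD rmorph_sum /= map_polyXn hornerD hornerXn horner_sum.
  have : Phi.['X_k] = 0 by apply: orbit_poly_root.
  rewrite horner_coef -(prednK (n := size Phi)) ?size_poly_gt0 ?monic_neq0 //.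
  rewrite big_ord_recr /= -lead_coefE (monicP Phi_monic) mul1r => E.
  rewrite -[RHS]addr0 -[X in _ = _ + X]E addrA -big_split /= addrC; congr (_ + _).
  apply: eq_bigr => j _; rewrite map_polyZ map_polyXn hornerZ hornerXn.
  by rewrite [Phi`_j * _]mulrC -mulrDr subrK mulrC.
by elim/big_ind: _ => // j _; apply: JM.
Qed.

Lemma basic_invariants_surj (c : 'I_n -> K) :
  exists v, forall i, (tnth f i).@[coords v] = c i.
Proof.
have [a Ja] := ideal_point (fiber_ideal_ideal c) (@fiber_ideal_proper c)
  (fiber_ideal_algebraic c).
have [v va] := coords_surj a; exists v => i; apply/eqP; rewrite -subr_eq0.
rewrite (meval_eq _ va) -[X in _ - X](mevalC a) -rmorphB; apply/eqP/Ja.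
exists (fun j => (j == i)%:R); rewrite (bigD1 i) //= eqxx mul1r big1 ?addr0 //.
by move=> j /negPf ->; rewrite mul0r.
Qed.

Variables (ds : n.-tuple nat).
Hypothesis f_homog : forall i, tnth f i \is (tnth ds i).-homog.

Lemma mem_eigenspace_union (d : nat) (z : K) (v : V) : d.-primitive_root z ->
  (exists2 g, g \in W & g v = z *: v) <->
  forall i, ~~ (d %| tnth ds i)%N -> (tnth f i).@[coords v] = 0.
Proof.
move=> z_d; have f_scale i : (tnth f i).@[coords (z *: v)] =
    z ^+ tnth ds i * (tnth f i).@[coords v].
  rewrite -meval_homog_scale //; apply: meval_eq => j.
  by rewrite /coords linearZ.
split=> [[g gW gv] i|f0].
  have : (tnth f i).@[coords (g v)] = (tnth f i).@[coords v].
    by rewrite -{1}(basic_invariant i gW) meval_poly_act (lker0_lfunK (memW_GL W_grp gW)).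
  rewrite gv f_scale (prim_order_dvd z_d) => /eqP.
  by rewrite -subr_eq0 -{2}[_.@[_]]mul1r -mulrBl mulf_eq0 subr_eq0 => /orP [->|/eqP ->].
apply: basic_invariants_separate => i; rewrite f_scale; have [d_i|/f0 ->] := boolP (d %| tnth ds i)%N.
  by move: d_i; rewrite (prim_order_dvd z_d) => /eqP ->; rewrite mul1r.
by rewrite mulr0.
Qed.

End BasicInvariants.

(** * Comparing divisibility of degrees with unions of eigenspaces *)

Lemma degrees_divisible_eqP (n : nat) (ds : n.-tuple nat) (d d' : nat) :
  degrees_divisible ds d = degrees_divisible ds d' <->
  forall i, (d %| tnth ds i)%N = (d' %| tnth ds i)%N.
Proof.
split=> [/eq_seq_msetP/perm_mem eq_ds i|eq_ds].
  by have := eq_ds (tnth ds i); rewrite !mem_filter mem_tnth !andbT.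
congr seq_mset; apply: eq_in_filter => _ /tnthP [i ->]; exact: eq_ds.
Qed.

Theorem theorem7p1 (R : realType) (V : vectType R[i]) (W : {fset 'End(V)})
    (ds : (\dim {:V}).-tuple nat) (zeta zeta' : R[i]) (d d' : nat)
    (W_refl : is_reflection_group W)
    (W_degs : is_degrees W ds)
    (zeta_d : d.-primitive_root zeta)
    (zeta'_d' : d'.-primitive_root zeta') :
  eigenspaces W zeta = eigenspaces W zeta' <->
  degrees_divisible ds d = degrees_divisible ds d'.
Proof.
have [W_grp _] := W_refl; have [_ [f f_basic f_homog]] := W_degs.
rewrite eigenspaces_eqP // degrees_divisible_eqP.
have in_union := mem_eigenspace_union W_grp f_basic f_homog.
split=> [eqU i|eq_ds v]; last first.
  rewrite (in_union _ _ _ zeta_d) (in_union _ _ _ zeta'_d').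
  by split=> f0 i; [rewrite -eq_ds | rewrite eq_ds]; apply: f0.
(* At this v only the i-th basic invariant is nonzero, so v lies in the union for a root of unity of
   order e exactly when e divides the i-th degree. *)
have [v fv] := basic_invariants_surj W_grp f_basic (fun j => (j == i)%:R).
have dvdE y e : e.-primitive_root y ->
    (exists2 g, g \in W & g v = y *: v) <-> (e %| tnth ds i)%N.
  move=> y_e; rewrite (in_union _ _ _ y_e); split=> [f0|e_i j].
    by apply: contraT => /f0; rewrite fv eqxx => /eqP; rewrite oner_eq0.
  by rewrite fv; case: eqP => // ->; rewrite e_i.
apply/idP/idP => [/(dvdE _ _ zeta_d)|/(dvdE _ _ zeta'_d')] /eqU.
  by move/(dvdE _ _ zeta'_d').
by move/(dvdE _ _ zeta_d).
Qed.
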